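(* Let $k$ be a field of characteristic $0$, let $\underline{\lambda}$ be a pure tuple of partitions, let $V_{\underline{\lambda}}$ be the universal homogeneous countable $\underline{\lambda}$-space, and let $G_{\underline{\lambda}}\subset \mathbf{GL}(V_{\underline{\lambda}})$ be its automorphism group. Then $G_{\underline{\lambda}}$ is linear-oligomorphic: for every $d\ge 0$ there is a finite-dimensional subspace $E\subset V_{\underline{\lambda}}$ such that for every $d$-dimensional subspace $W\subset V_{\underline{\lambda}}$ there exists $g\in G_{\underline{\lambda}}$ with $gW\subset E$.
   Context: For a partition $\lambda$ of $n$, $\mathbf{S}_\lambda(V)=\operatorname{Hom}_{\mathfrak{S}_n}(S^\lambda,V^{\otimes n})$ is the Schur functor ($S^\lambda$ the Specht module over $k$); a $\lambda$-form on $V$ is a linear map $\mathbf{S}_\lambda(V)\to k$. For a tuple $\underline{\lambda}=[\lambda_1,\ldots,\lambda_r]$ of partitions (pure: all $\lambda_i$ non-empty), a $\underline{\lambda}$-space is a $k$-vector space with a tuple $(\omega_1,\ldots,\omega_r)$, $\omega_i$ a $\lambda_i$-form. Embeddings are injective linear maps pulling back the structure; isomorphisms are bijective embeddings. A $\underline{\lambda}$-space is universal if every finite-dimensional $\underline{\lambda}$-space embeds into it, and homogeneous if every isomorphism between finite-dimensional subspaces (with induced structures) extends to an automorphism. For pure $\underline{\lambda}$ there is, up to isomorphism, a unique universal homogeneous $\underline{\lambda}$-space of countably infinite dimension, denoted $V_{\underline{\lambda}}$. A subgroup $G\subset\mathbf{GL}(V)$ is linear-oligomorphic if for every $d\ge0$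 there is a finite-dimensional $E\subset V$ such that every $d$-dimensional subspace $W$ admits $g\in G$ with $gW\subset E$. *)

(* Defs.v *)
From HB Require Import structures.
From mathcomp Require Import fingroup perm.
From mathcomp Require Import all_boot all_order all_algebra.
From mathcomp Require Import boolp functions.
From mathcomp Require Import finmap.
From mathcomp Require Import monalg.

Set Implicit Arguments.
Unset Strict Implicit.
Unset Printing Implicit Defensive.

Import GRing.Theory.
Local Open Scope ring_scope.
Local Open Scope quotient_scope.

(* Subspaces of a possibly infinite-dimensional space [V] are the boolean
   predicates [U : submodClosed V]; by [asbool] every subspace is of this
   form.  [subsp U] is [U] regarded as a vector space in its own right. *)
Record subsp (k : fieldType) (V : lmodType k) (U : submodClosed V) := Subsp {
  subsp_val :> V;
  subsp_valP : subsp_val \in U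
}.

Section Subspace.
Variables (k : fieldType) (V : lmodType k) (U : submodClosed V).
HB.instance Definition _ := [isSub for @subsp_val k V U].
HB.instance Definition _ := [Choice of subsp U by <:].
HB.instance Definition _ := [SubChoice_isSubLmodule of subsp U by <:].

Definition subsp_incl : {linear subsp U -> V} := \val.
End Subspace.

Definition has_dim (k : fieldType) (M : lmodType k) (d : nat) : Prop :=
  inhabited (Vector.axiom d M).

Definition has_countably_infinite_dim (k : fieldType) (M : lmodType k) : Prop :=
  exists b : nat -> M,
    (forall n (c : 'I_n -> k), \sum_(i < n) c i *: b i = 0 -> forall i, c i = 0) /\
    (forall v : M, exists n (c : 'I_n -> k), v = \sum_(i < n) c i *: b i).

Section Span.
Variables (k : fieldType) (V : lmodType k) (X : V -> Prop).

Definition span_pred : {pred V} := fun v =>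
  `[< exists n (c : 'I_n -> k) (x : 'I_n -> V),
        (forall i, X (x i)) /\ v = \sum_(i < n) c i *: x i >].

Lemma span_pred_closed : submod_closed span_pred.
Proof.
split; first by apply/asboolP; exists 0, (fun=> 0), (fun=> 0);
    split=> [[]|] //; rewrite big_ord0.
move=> a u v /asboolP[n [c [x [Xx ->]]]] /asboolP[m [d [y [Xy ->]]]].
apply/asboolP; exists (n + m)%N.
exists (fun i => match fintype.split i with inl i => a * c i | inr j => d j end).
exists (fun i => match fintype.split i with inl i => x i | inr j => y j end).
split; first by move=> i; case: fintype.split.
rewrite big_split_ord scaler_sumr /=; congr (_ + _); apply: eq_bigr => i _.
  by rewrite (unsplitK (inl i)) scalerA.
by rewrite (unsplitK (inr i)).
Qed.

HB.instance Definition _ :=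
  GRing.isSubmodClosed.Build k V span_pred span_pred_closed.

Definition lspan : submodClosed V := span_pred.

Lemma mem_lspan v : X v -> v \in lspan.
Proof.
move=> Xv; apply/asboolP; exists 1%N, (fun=> 1), (fun=> v); split=> //.
by rewrite big_ord1 scale1r.
Qed.
End Span.

Section LinearQuotient.
Variables (k : fieldType) (V : lmodType k) (U : submodClosed V).

Definition lequiv (x y : V) := x - y \in U.

Let U_zmod : zmod_closed U := GRing.submod_closedB (submodClosedP U).
Let UB : {in U &, forall x y, x - y \in U} := U_zmod.2.

Lemma lequiv_is_equiv : equiv_class_of lequiv.
Proof.
split=> [x|x y|y x z]; rewrite /lequiv ?subrr ?rpred0 //.
  by apply/idP/idP => h; rewrite -opprB -sub0r UB ?rpred0.
by move=> h1 h2; rewrite -[x](subrK y) -addrA rpredD.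
Qed.
Canonical lequiv_equiv := EquivRelPack lequiv_is_equiv.
Canonical lequiv_encModRel := defaultEncModRel lequiv.

Definition lquot := {eq_quot lequiv}.
HB.instance Definition _ := EqQuotient.on lquot.
HB.instance Definition _ := Choice.on lquot.

Lemma lquotP x y : reflect (\pi_lquot x = \pi_lquot y) (x - y \in U).
Proof. by apply: (iffP idP) => h; [apply/eqP|move/eqP: h]; rewrite piE. Qed.

Lemma lquot_repr x : x - repr (\pi_lquot x) \in U.
Proof. by apply/lquotP; rewrite reprK. Qed.

Definition lquot_zero : lquot := \pi_lquot 0.
Definition lquot_add (x y : lquot) : lquot := \pi_lquot (repr x + repr y).
Definition lquot_opp (x : lquot) : lquot := \pi_lquot (- repr x).
Definition lquot_scale a (x : lquot) : lquot := \pi_lquot (a *: repr x).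

Lemma lquot_piD x y : lquot_add (\pi_lquot x) (\pi_lquot y) = \pi_lquot (x + y).
Proof.
apply/esym/lquotP; rewrite opprD addrACA.
by apply: rpredD; exact: lquot_repr.
Qed.
Lemma lquot_piN x : lquot_opp (\pi_lquot x) = \pi_lquot (- x).
Proof. by apply/lquotP; rewrite opprK addrC lquot_repr. Qed.
Lemma lquot_piZ a x : lquot_scale a (\pi_lquot x) = \pi_lquot (a *: x).
Proof.
by apply/esym/lquotP; rewrite -scalerBr; apply: rpredZ; exact: lquot_repr.
Qed.

Lemma lquot_ind (P : lquot -> Prop) : (forall x, P (\pi_lquot x)) -> forall q, P q.
Proof. by move=> h q; rewrite -[q]reprK. Qed.

Lemma lquot_addA : associative lquot_add.
Proof.
elim/lquot_ind=> x; elim/lquot_ind=> y; elim/lquot_ind=> z.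
by rewrite !lquot_piD addrA.
Qed.
Lemma lquot_addC : commutative lquot_add.
Proof.
by elim/lquot_ind=> x; elim/lquot_ind=> y; rewrite !lquot_piD addrC.
Qed.
Lemma lquot_add0 : left_id lquot_zero lquot_add.
Proof. by elim/lquot_ind=> x; rewrite lquot_piD add0r. Qed.
Lemma lquot_addN : left_inverse lquot_zero lquot_opp lquot_add.
Proof. by elim/lquot_ind=> x; rewrite lquot_piN lquot_piD addNr. Qed.

HB.instance Definition _ :=
  GRing.isZmodule.Build lquot lquot_addA lquot_addC lquot_add0 lquot_addN.

Lemma lquot_scaleA a b x :
  lquot_scale a (lquot_scale b x) = lquot_scale (a * b) x.
Proof. by elim/lquot_ind: x => x; rewrite !lquot_piZ scalerA. Qed.
Lemma lquot_scale1 : left_id 1 lquot_scale.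
Proof. by elim/lquot_ind=> x; rewrite lquot_piZ scale1r. Qed.
Lemma lquot_scaleDr : right_distributive lquot_scale +%R.
Proof.
move=> a; elim/lquot_ind=> x; elim/lquot_ind=> y.
by rewrite [_ + _]lquot_piD !lquot_piZ [RHS]lquot_piD scalerDr.
Qed.
Lemma lquot_scaleDl v : {morph lquot_scale^~ v : a b / a + b}.
Proof.
move=> a b; elim/lquot_ind: v => x.
by rewrite !lquot_piZ [RHS]lquot_piD scalerDl.
Qed.

HB.instance Definition _ := GRing.Zmodule_isLmodule.Build k lquot
  lquot_scaleA lquot_scale1 lquot_scaleDr lquot_scaleDl.

Definition lproj (x : V) : lquot := \pi_lquot x.

Lemma lproj_is_linear : linear lproj.
Proof.
move=> a x y; rewrite /lproj -(lquot_piD (a *: x) y) -(lquot_piZ a x).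
by [].
Qed.
HB.instance Definition _ :=
  GRing.isLinear.Build k V lquot _ lproj lproj_is_linear.

Lemma lprojP x y : reflect (lproj x = lproj y) (x - y \in U).
Proof. exact: lquotP. Qed.

Lemma lproj_ind (P : lquot -> Prop) : (forall x, P (lproj x)) -> forall q, P q.
Proof. exact: lquot_ind. Qed.

Section Lift.
Variables (W : lmodType k) (f : {linear V -> W}).
Hypothesis fU : {in U, forall x, f x = 0}.

Definition lquot_lift (q : lquot) : W := f (repr q).

Lemma lquot_liftE x : lquot_lift (lproj x) = f x.
Proof.
by apply/esym/eqP; rewrite -subr_eq0 -raddfB /= fU // lquot_repr.
Qed.

Lemma lquot_lift_is_linear : linear lquot_lift.
Proof.
move=> a; elim/lproj_ind=> x; elim/lproj_ind=> y.
by rewrite -linearP !lquot_liftE linearP.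
Qed.
End Lift.
End LinearQuotient.

Definition gen (k : fieldType) (K : choiceType) (j : K) : {malg k[K]} := << j >>.

Section FreeLift.
Variables (k : fieldType) (K : choiceType) (W : lmodType k) (g : K -> W).
Local Open Scope fset_scope.

Definition free_lift (x : {malg k[K]}) : W :=
  \sum_(j <- msupp x) x@_j *: g j.

Lemma free_liftEw (x : {malg k[K]}) (D : {fset K}) : msupp x `<=` D ->
  free_lift x = \sum_(j <- D) x@_j *: g j.
Proof.
move=> sD; rewrite /free_lift (big_fset_incl _ sD) //= => j _ /mcoeff_outdom ->.
by rewrite scale0r.
Qed.

Lemma free_lift_is_linear : linear free_lift.
Proof.
move=> a x y; set D := msupp (a *: x + y) `|` (msupp x `|` msupp y).
have sx : msupp x `<=` D by rewrite /D fsubsetU // fsubsetUl orbT.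
have sy : msupp y `<=` D by rewrite /D fsubsetU // fsubsetUr orbT.
have sxy : msupp (a *: x + y) `<=` D by rewrite fsubsetUl.
rewrite (free_liftEw sx) (free_liftEw sy) (free_liftEw sxy).
rewrite scaler_sumr -big_split /=; apply: eq_bigr => j _.
by rewrite mcoeffD mcoeffZ scalerDl scalerA.
Qed.
HB.instance Definition _ :=
  GRing.isLinear.Build k {malg k[K]} W _ free_lift free_lift_is_linear.

Lemma free_liftU j : free_lift (gen k j) = g j.
Proof. by rewrite /free_lift /gen msuppU oner_eq0 big_seq_fset1 mcoeffUU scale1r. Qed.

Lemma free_lift_ext (f1 f2 : {linear {malg k[K]} -> W}) :
  (forall j, f1 (gen k j) = f2 (gen k j)) -> f1 =1 f2.
Proof.
move=> h x; rewrite [x]monalgE !raddf_sum; apply: eq_bigr => j _ /=.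
have -> : << x@_j *g j >> = x@_j *: gen k j.
  by apply/malgP=> i; rewrite mcoeffZ !mcoeffU mulr_natr.
by rewrite !linearZ /= h.
Qed.
End FreeLift.

Section TensorPower.
Variables (k : fieldType) (n : nat) (V : lmodType k).

Definition upd (v : {ffun 'I_n -> V}) (i : 'I_n) (x : V) : {ffun 'I_n -> V} :=
  [ffun j => if j == i then x else v j].

Definition multilinear (W : lmodType k) (g : {ffun 'I_n -> V} -> W) : Prop :=
  forall v i a x y,
    g (upd v i (a *: x + y)) = a *: g (upd v i x) + g (upd v i y).

Definition tensor_rel (t : {malg k[{ffun 'I_n -> V}]}) : Prop :=
  exists v i a x y, t = gen k (upd v i (a *: x + y))
    - (a *: gen k (upd v i x) + gen k (upd v i y)).

(* The tensor power: the free module on [n]-tuples of vectors, modulo the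
   relations of multilinearity. *)
Definition tpow : Type := lquot (lspan tensor_rel).
HB.instance Definition _ := GRing.Lmodule.on tpow.

Definition tens (v : {ffun 'I_n -> V}) : tpow := lproj (lspan tensor_rel) (gen k v).

Lemma tens_multilinear : multilinear tens.
Proof.
move=> v i a x y; rewrite /tens -linearP; apply/lprojP/mem_lspan.
by exists v, i, a, x, y.
Qed.

Section Lift.
Variables (W : lmodType k) (g : {ffun 'I_n -> V} -> W).

(* The linear map determined by [g] on pure tensors; meaningful only when [g]
   is multilinear. *)
Definition tlift (t : tpow) : W := lquot_lift (free_lift g) t.

Hypothesis g_ml : multilinear g.

Lemma tlift_wd : {in lspan tensor_rel, forall t, free_lift g t = 0}.
Proof.
move=> t /asboolP[m [c [x [Xx ->]]]].
rewrite raddf_sum big1 // => j _ /=; rewrite linearZ /=.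
have [v [i [a [y [z ->]]]]] := Xx j.
by rewrite raddfB /= linearP /= !free_liftU g_ml subrr scaler0.
Qed.

Lemma tlift_is_linear : linear tlift.
Proof. exact/lquot_lift_is_linear/tlift_wd. Qed.

Lemma tlift_tens v : tlift (tens v) = g v.
Proof. by rewrite /tlift /tens (lquot_liftE tlift_wd) /= free_liftU. Qed.
End Lift.

Lemma tpow_ext (W : lmodType k) (f1 f2 : tpow -> W) :
  linear f1 -> linear f2 ->
  (forall v, f1 (tens v) = f2 (tens v)) -> f1 =1 f2.
Proof.
move=> l1 l2 h; elim/lproj_ind=> x.
pose L1 := GRing.isLinear.Build k tpow W _ f1 l1.
pose F1 : {linear tpow -> W} := HB.pack f1 L1.
pose L2 := GRing.isLinear.Build k tpow W _ f2 l2.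
pose F2 : {linear tpow -> W} := HB.pack f2 L2.
exact: (@free_lift_ext _ _ _ (F1 \o lproj (lspan tensor_rel))
                       (F2 \o lproj (lspan tensor_rel))).
Qed.

(* Place permutation: the vector in position [i] moves to position [s i]. *)
Definition perm_tens (s : 'S_n) (v : {ffun 'I_n -> V}) : tpow :=
  tens [ffun i => v ((s^-1)%g i)].

Lemma perm_tens_ml s : multilinear (perm_tens s).
Proof.
move=> v i a x y; rewrite /perm_tens.
have E z : [ffun j => upd v i z ((s^-1)%g j)] =
    upd [ffun j => v ((s^-1)%g j)] (s i) z.
  by apply/ffunP=> j; rewrite !ffunE -(inj_eq (@perm_inj _ s)) permKV.
by rewrite !E tens_multilinear.
Qed.

Definition tpow_act (s : 'S_n) : tpow -> tpow := tlift (perm_tens s).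

Lemma tpow_act_is_linear s : linear (tpow_act s).
Proof. exact/tlift_is_linear/perm_tens_ml. Qed.
HB.instance Definition _ s :=
  GRing.isLinear.Build k tpow tpow _ (tpow_act s) (tpow_act_is_linear s).

Lemma tpow_actE s v : tpow_act s (tens v) = tens [ffun i => v ((s^-1)%g i)].
Proof. exact/tlift_tens/perm_tens_ml. Qed.
End TensorPower.

Section TensorMap.
Variables (k : fieldType) (n : nat) (V W : lmodType k) (f : {linear V -> W}).

Definition map_tens (v : {ffun 'I_n -> V}) : tpow n W := tens [ffun i => f (v i)].

Lemma map_tens_ml : multilinear map_tens.
Proof.
move=> v i a x y; rewrite /map_tens.
have E z : [ffun j => f (upd v i z j)] = upd [ffun j => f (v j)] i (f z).
  by apply/ffunP=> j; rewrite !ffunE; case: eqP.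
by rewrite !E linearP tens_multilinear.
Qed.

Definition tpow_map : tpow n V -> tpow n W := tlift map_tens.

Lemma tpow_map_is_linear : linear tpow_map.
Proof. exact/tlift_is_linear/map_tens_ml. Qed.
HB.instance Definition _ :=
  GRing.isLinear.Build k (tpow n V) (tpow n W) _ tpow_map tpow_map_is_linear.

Lemma tpow_mapE v : tpow_map (tens v) = tens [ffun i => f (v i)].
Proof. exact/tlift_tens/map_tens_ml. Qed.

Lemma tpow_map_act s t : tpow_map (tpow_act s t) = tpow_act s (tpow_map t).
Proof.
apply: (tpow_ext (f1 := tpow_map \o tpow_act s) (f2 := tpow_act s \o tpow_map)).
- exact: linearP.
- exact: linearP.
move=> v /=; rewrite tpow_actE !tpow_mapE tpow_actE; congr tens.
by apply/ffunP=> i; rewrite !ffunE.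
Qed.
End TensorMap.

Record intpart := IntPart {
  parts :> seq nat;
  _ : sorted geq parts && (0%N \notin parts)
}.

Section Specht.
Variables (k : fieldType) (lam : intpart).
Let n := sumn lam.

(* The cells of the Young diagram of [lam] are numbered row by row by ['I_n];
   [row_of] and [col_of] give the row and the column of a cell. *)
Definition row_of (c : 'I_n) : 'I_(size lam) :=
  Ordinal (reshape_indexP (ltn_ord c)).
Definition col_of (c : 'I_n) : nat := reshape_offset lam c.

(* A tabloid is given by the row in which each entry lies.  [tabmod] contains
   the permutation module of tabloids of shape [lam] as the functions supported
   on the assignments that put [nth 0 lam r] entries in row [r]. *)
Definition tabmod := {ffun {ffun 'I_n -> 'I_(size lam)} -> k^o}.

Definition tabloid_act (s : 'S_n) (T : {ffun 'I_n -> 'I_(size lam)}) :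
  {ffun 'I_n -> 'I_(size lam)} := [ffun i => T ((s^-1)%g i)].

Definition tabloid_vec (T : {ffun 'I_n -> 'I_(size lam)}) : tabmod :=
  [ffun T' => (T' == T)%:R].

Definition tabmod_act (s : 'S_n) (x : tabmod) : tabmod :=
  \sum_T x T *: tabloid_vec (tabloid_act s T).

(* A tableau is a bijection [t] from entries to cells. *)
Definition tabloid_of (t : 'S_n) : {ffun 'I_n -> 'I_(size lam)} :=
  [ffun i => row_of (t i)].

Definition col_stab (t : 'S_n) : {set 'S_n} :=
  [set s : 'S_n | [forall i, col_of (t (s i)) == col_of (t i)]].

Definition polytabloid (t : 'S_n) : tabmod :=
  \sum_(s in col_stab t)
    (-1) ^+ odd_perm s *: tabloid_vec (tabloid_act s (tabloid_of t)).

Definition specht_space : {vspace tabmod} :=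
  <<[seq polytabloid t | t : 'S_n]>>%VS.

Definition specht := subvs_of specht_space.
HB.instance Definition _ := Vector.on specht.

Lemma tabmod_act_is_linear s : linear (tabmod_act s).
Proof.
move=> a x y; rewrite /tabmod_act scaler_sumr -big_split /=.
by apply: eq_bigr => T _; rewrite !ffunE scalerDl scalerA.
Qed.
HB.instance Definition _ s :=
  GRing.isLinear.Build k tabmod tabmod _ (tabmod_act s) (tabmod_act_is_linear s).

Lemma tabmod_actE s T :
  tabmod_act s (tabloid_vec T) = tabloid_vec (tabloid_act s T).
Proof.
rewrite /tabmod_act (bigD1 T) //= big1 ?addr0 => [|T' /negPf nT].
  by rewrite ffunE eqxx scale1r.
by rewrite ffunE nT scale0r.
Qed.

Lemma tabloid_actM s u T :
  tabloid_act s (tabloid_act u T) = tabloid_act (u * s)%g T.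
Proof. by apply/ffunP=> i; rewrite !ffunE invMg permM. Qed.

Lemma tabmod_act_polytabloid s t :
  tabmod_act s (polytabloid t) = polytabloid (s^-1 * t)%g.
Proof.
rewrite /polytabloid raddf_sum /=.
rewrite [RHS](reindex_inj (conjg_inj s)) /=; apply: eq_big => [u|u _].
  rewrite !inE; apply/forallP/forallP => h i.
    by move: (h ((s^-1)%g i)); rewrite !(permM, permJ, permK, conjgE) .
  by move: (h (s i)); rewrite !(permM, permK, conjgE).
rewrite linearZ /= tabmod_actE odd_permJ; congr (_ *: tabloid_vec _).
rewrite tabloid_actM; apply/ffunP=> i; rewrite !ffunE.
by rewrite !(permM, permK, conjgE, invMg, invgK, permKV).
Qed.

Lemma tabmod_act_specht s : {in specht_space, forall x, tabmod_act s x \in specht_space}.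
Proof.
move=> x /coord_span ->; rewrite raddf_sum /=; apply: memv_suml => i _.
rewrite linearZ /=; apply/memvZ.
set X := (X in X`_i).
have /mapP[t _ ->] : X`_i \in [seq polytabloid t | t : 'S_n].
  by apply: mem_nth; case: i => i /=; rewrite size_image.
rewrite tabmod_act_polytabloid; apply/memv_span/mapP.
by exists (s^-1 * t)%g; rewrite ?mem_enum.
Qed.

Definition specht_act (s : 'S_n) (x : specht) : specht :=
  vsproj specht_space (tabmod_act s (vsval x)).

Lemma specht_actE s x : vsval (specht_act s x) = tabmod_act s (vsval x).
Proof. by rewrite vsprojK // tabmod_act_specht // subvsP. Qed.
End Specht.

Section Schur.
Variables (k : fieldType) (lam : intpart) (V : lmodType k).
Let n := sumn lam.

Definition is_intertwiner (phi : specht k lam -> tpow n V) : Prop :=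
  linear phi /\ forall (s : 'S_n) x, phi (specht_act s x) = tpow_act s (phi x).

Definition intertwiner_pred : {pred specht k lam -> tpow n V} :=
  fun phi => `[< is_intertwiner phi >].

Lemma intertwiner_closed : submod_closed intertwiner_pred.
Proof.
split=> [|a f g /asboolP[lf ef] /asboolP[lg eg]]; apply/asboolP; split.
- by move=> a x y; rewrite /= scaler0 addr0.
- by move=> s x; rewrite [RHS]raddf0.
- move=> b x y; rewrite !(addrfctE, scalrfctE) /= lf lg.
  by rewrite !scalerDr !scalerA mulrC addrACA.
- by move=> s x; rewrite !(addrfctE, scalrfctE) /= ef eg linearP.
Qed.

HB.instance Definition _ := GRing.isSubmodClosed.Build k
  (specht k lam -> tpow n V) intertwiner_pred intertwiner_closed.

(* The value at [V] of the Schur functor of [lam]: the equivariant linear maps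
   from the Specht module to the tensor power. *)
Definition schur : Type := subsp (intertwiner_pred : submodClosed _).
HB.instance Definition _ := GRing.Lmodule.on schur.
End Schur.

Section SchurMap.
Variables (k : fieldType) (lam : intpart) (V W : lmodType k) (f : {linear V -> W}).

Lemma schur_map_subproof (phi : schur lam V) :
  (fun x => tpow_map f (val phi x)) \in @intertwiner_pred k lam W.
Proof.
have /asboolP[l e] := valP phi.
apply/asboolP; split=> [a x y|s x]; first by rewrite l linearP.
by rewrite e tpow_map_act.
Qed.

Definition schur_map (phi : schur lam V) : schur lam W :=
  Subsp (schur_map_subproof phi).

Lemma schur_map_is_linear : linear schur_map.
Proof.
move=> a x y; apply/val_inj/funext => t /=.
by rewrite !(addrfctE, scalrfctE) /= linearP.
Qed.
HB.instance Definition _ :=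
  GRing.isLinear.Build k (schur lam V) (schur lam W) _ schur_map schur_map_is_linear.
End SchurMap.

Lemma schur_map_id (k : fieldType) (lam : intpart) (V : lmodType k)
  (f : {linear V -> V}) : f =1 id -> @schur_map k lam V V f =1 id.
Proof.
move=> fid phi; apply/val_inj/funext => x /=; move: (val phi x) => t.
apply: (tpow_ext (f1 := tpow_map f) (f2 := id)) => // [|v]; first exact: linearP.
by rewrite tpow_mapE; congr tens; apply/ffunP=> i; rewrite ffunE fid.
Qed.

Lemma schur_map_comp (k : fieldType) (lam : intpart) (U V W : lmodType k)
  (f : {linear V -> W}) (g : {linear U -> V}) (h : {linear U -> W}) :
  h =1 f \o g -> @schur_map k lam U W h =1 schur_map f \o schur_map g.
Proof.
move=> hE phi; apply/val_inj/funext => x /=; move: (val phi x) => t.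
apply: (tpow_ext (f1 := tpow_map h) (f2 := tpow_map f \o tpow_map g)).
- exact: linearP.
- exact: linearP.
move=> v /=; rewrite !tpow_mapE; congr tens.
by apply/ffunP=> i; rewrite !ffunE hE.
Qed.

Section LamSpace.
Variables (k : fieldType) (r : nat) (lam : r.-tuple intpart).

Definition pure : Prop := forall i : 'I_r, parts (tnth lam i) <> [::].

Definition lam_structure (V : lmodType k) : Type :=
  forall i : 'I_r, {scalar schur (tnth lam i) V}.

Definition pullback (V W : lmodType k) (f : {linear V -> W})
  (w : lam_structure W) : lam_structure V :=
  fun i => (w i \o schur_map f : {scalar schur (tnth lam i) V}).

Definition preserves (V W : lmodType k) (v : lam_structure V)
  (w : lam_structure W) (f : {linear V -> W}) : Prop :=
  forall i, pullback f w i =1 v i.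

Definition embedding (V W : lmodType k) (v : lam_structure V)
  (w : lam_structure W) (f : {linear V -> W}) : Prop :=
  injective f /\ preserves v w f.

Definition isomorphism (V W : lmodType k) (v : lam_structure V)
  (w : lam_structure W) (f : {linear V -> W}) : Prop :=
  bijective f /\ embedding v w f.

Definition induced (V : lmodType k) (w : lam_structure V) (U : submodClosed V) :
  lam_structure (subsp U) := pullback (subsp_incl U) w.

Definition universal (V : lmodType k) (w : lam_structure V) : Prop :=
  forall (W : vectType k) (v : lam_structure W),
    exists f : {linear W -> V}, embedding v w f.

Definition homogeneous (V : lmodType k) (w : lam_structure V) : Prop :=
  forall (A B : submodClosed V),
    (exists d, has_dim (subsp A) d) -> (exists d, has_dim (subsp B) d) ->
  forall f : {linear subsp A -> subsp B},
    isomorphism (induced w A) (induced w B) f ->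
  exists g : {linear V -> V},
    isomorphism w w g /\ forall a : subsp A, g (\val a) = \val (f a).
End LamSpace.

Record GLsubgroup (k : fieldType) (V : lmodType k) := GLSubgroup {
  GLmem :> {linear V -> V} -> Prop;
  GLmem_bij : forall g, GLmem g -> bijective g;
  GLmem1 : GLmem idfun;
  GLmemM : forall g h, GLmem g -> GLmem h -> GLmem (g \o h);
  GLmemV : forall g h : {linear V -> V},
    GLmem g -> cancel g h -> cancel h g -> GLmem h
}.

Definition linear_oligomorphic (k : fieldType) (V : lmodType k)
    (G : GLsubgroup V) : Prop :=
  forall d : nat, exists E : submodClosed V,
    (exists e, has_dim (subsp E) e) /\
    forall W : submodClosed V, has_dim (subsp W) d ->
      exists g : {linear V -> V}, G g /\ {in W, forall x, g x \in E}.

Section AutomorphismGroup.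
Variables (k : fieldType) (r : nat) (lam : r.-tuple intpart).
Variables (V : lmodType k) (w : lam_structure lam V).

Lemma iso_bij g : isomorphism w w g -> bijective g.
Proof. by case. Qed.

Lemma iso1 : isomorphism w w idfun.
Proof.
split; first by exists id.
by split=> // i phi /=; rewrite schur_map_id.
Qed.

Lemma isoM (g h : {linear V -> V}) :
  isomorphism w w g -> isomorphism w w h -> isomorphism w w (g \o h).
Proof.
move=> [bg [ig pg]] [bh [ih ph]]; split; first exact: bij_comp.
split=> [|i phi /=]; first exact: inj_comp.
have -> : schur_map (g \o h) phi = schur_map g (schur_map h phi).
  exact: schur_map_comp.
by rewrite [LHS](pg i) [LHS](ph i).
Qed.

Lemma isoV (g h : {linear V -> V}) :
  isomorphism w w g -> cancel g h -> cancel h g -> isomorphism w w h.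
Proof.
move=> [bg [ig pg]] gK hK; split; first by exists g.
split=> [|i phi /=]; first exact: can_inj hK.
rewrite -(pg i) /=; congr (w i _).
rewrite -[RHS](@schur_map_id _ _ _ (g \o h)) //.
exact/esym/schur_map_comp.
Qed.

Definition automorphism_group : GLsubgroup V :=
  GLSubgroup iso_bij iso1 isoM isoV.
End AutomorphismGroup.

(* Main.v *)
(* By homogeneity it suffices to find one finite-dimensional space of type
   [lam] into which every [d]-dimensional one embeds: its copy in [V], given by
   universality, is the required [E].  Every form on a [d]-dimensional [M] with
   coordinates [x_1, ..., x_d] is
     phi |-> \sum_(j, a) c_(j,a) (x_(a 1) * ... * x_(a n)) (phi b_j)
   where [b] is a basis of the Specht module and [a] ranges over the maps from
   the [n] places to [{1, ..., d}].  Hence it is the pullback of the form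
     phi |-> \sum_(j, a) (y_(j,a,1) * ... * y_(j,a,n)) (phi b_j)
   in independent variables [y], under y_(j,a,1) := c_(j,a) x_(a 1) and
   y_(j,a,p) := x_(a p) for p > 1.  Absorbing the coefficient into a variable
   needs n > 0, that is, purity.  Taking these variables for every [i] together
   with [d] more, which receive the coordinates, makes the map injective. *)

Require Import Defs.
From HB Require Import structures.
From mathcomp Require Import all_boot all_order all_algebra.
From mathcomp Require Import boolp functions.

Set Implicit Arguments.
Unset Strict Implicit.
Unset Printing Implicit Defensive.

Import GRing.Theory.
Local Open Scope ring_scope.

(** * Linear functionals and their common kernels *)

Lemma scalar_span (k : fieldType) (L : lmodType k) (N : nat)
    (m : 'I_N -> L -> k) (u : L -> k) : (forall i, scalar (m i)) -> scalar u ->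
    (forall x, (forall i, m i x = 0) -> u x = 0) ->
  exists c : 'I_N -> k, forall x, u x = \sum_(i < N) c i * m i x.
Proof.
(* [u] is corrected by a multiple of the last functional so that it vanishes on
   the common kernel of the others. *)
elim: N m u => [|N IH] m u lm lu hu.
  by exists (fun=> 0) => x; rewrite big_ord0; apply: hu => -[].
pose z := m ord_max; pose m' i := m (lift ord_max i).
have [b hb] : exists b, forall x, (forall i, m' i x = 0) -> u x = b * z x.
  (* Either [z] is nonzero at some [x0] in the common kernel of the [m'], which forces
     [b = u x0 / z x0], or [z] vanishes there, hence so does [u], and [b = 0] works. *)
  have [[x0 [h0 z0]]|nx] :=
      pselect (exists x0, (forall i, m' i x0 = 0) /\ z x0 != 0).
    exists (u x0 / z x0) => x hx.
    have: u (- (z x / z x0) *: x0 + x) = 0.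
      apply: hu => i; case: (unliftP ord_max i) => [j|] ->; rewrite lm /=.
        by rewrite [m _ x0]h0 [m _ x]hx mulr0 addr0.
      by rewrite mulNr -[m _ x0]/(z x0) divfK // addNr.
    rewrite lu => /eqP; rewrite mulNr addrC subr_eq0 => /eqP->.
    by rewrite mulrC mulrA mulrAC.
  exists 0 => x hx; rewrite mul0r; apply: hu => i.
  case: (unliftP ord_max i) => [j|] ->; first exact: hx.
  by apply/eqP/negP => /negP zx; apply: nx; exists x.
have lu' : scalar (fun x => u x - b * z x).
  move=> a x y; rewrite lu [z _]lm /= mulrDr mulrBr opprD addrACA.
  by rewrite mulrCA.
have [|c hc] := IH m' _ (fun i => lm _) lu'.
  by move=> x /hb ->; rewrite subrr.
exists (fun i => oapp c b (unlift ord_max i)) => x.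
rewrite (bigD1_ord ord_max) //= unlift_none /=.
under eq_bigr do rewrite liftK /=.
by rewrite -hc addrC subrK.
Qed.

(** * Products of functionals on a tensor power *)

Section ProductForm.
Variables (k : fieldType) (n : nat).

(** The tensor product of the functionals [y p]. They are plain functions, so that composites and
    multiples need no bundling; the value is meaningful only when each is linear. *)
Definition prod_form (X : lmodType k) (y : 'I_n -> X -> k) : tpow n X -> k :=
  tlift (W := k^o) (fun v : {ffun 'I_n -> X} => \prod_p y p (v p) : k^o).

Variable X : lmodType k.

Lemma prod_form_ml (y : 'I_n -> X -> k) : (forall p, scalar (y p)) ->
  multilinear (fun v : {ffun 'I_n -> X} => \prod_p y p (v p) : k^o).
Proof.
move=> ly v i a s t /=.
rewrite !(bigD1 (P := xpredT) i) //= !ffunE eqxx ly.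
have E z : \prod_(p | p != i) y p (upd v i z p) = \prod_(p | p != i) y p (v p).
  by apply: eq_bigr => p /negPf np; rewrite ffunE np.
by rewrite !E mulrDl -mulrA.
Qed.

Variable y : 'I_n -> X -> k.
Hypothesis ly : forall p, scalar (y p).

Lemma prod_form_scalar : scalar (prod_form y).
Proof. exact: (tlift_is_linear (prod_form_ml ly)). Qed.

Lemma prod_form_tens v : prod_form y (tens v) = \prod_p y p (v p).
Proof. exact: (tlift_tens (prod_form_ml ly)). Qed.
End ProductForm.

Lemma prod_form_map (k : fieldType) n (X Y : lmodType k) (f : {linear X -> Y})
    (y : 'I_n -> Y -> k) : (forall p, scalar (y p)) ->
  forall t, prod_form y (tpow_map f t) = prod_form (fun p => y p \o f) t.
Proof.
move=> ly; have lyf p : scalar (y p \o f).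
  by move=> a u v; rewrite /= linearP ly.
apply: (tpow_ext (W := k^o)) => [a u v||v].
- by rewrite linearP; exact: (prod_form_scalar ly).
- exact: (prod_form_scalar lyf).
by rewrite tpow_mapE !prod_form_tens //; apply: eq_bigr => p _; rewrite ffunE.
Qed.

(** Absorbs a coefficient into the single factor at [p0]; such a place exists only if [n > 0]. *)
Lemma prod_form_scale (k : fieldType) n (X : lmodType k) (p0 : 'I_n) (c : k)
    (y : 'I_n -> X -> k) : (forall p, scalar (y p)) ->
  forall t, prod_form (fun p x => (if p == p0 then c else 1) * y p x) t =
    c * prod_form y t.
Proof.
move=> ly; have lcy p : scalar (fun x => (if p == p0 then c else 1) * y p x).
  by move=> a u v; rewrite ly mulrDr mulrCA.
apply: (tpow_ext (W := k^o)) => [|a u v|v]; first exact: (prod_form_scalar lcy).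
  by rewrite prod_form_scalar // mulrDr; congr (_ + _); apply: mulrCA.
rewrite !prod_form_tens // big_split /= -big_mkcond /=; congr (_ * _).
by rewrite big_pred1_eq.
Qed.

Lemma schur_valP (k : fieldType) lam (M : lmodType k) a (s t : schur lam M) z :
  val (a *: s + t) z = a *: val s z + val t z.
Proof. by rewrite /= addrfctE scalrfctE. Qed.

(** * Expansion of tensors and forms in dual bases *)

Section FiniteDimensional.
Variables (k : fieldType) (M : lmodType k) (d : nat).
Variables (x : 'I_d -> {scalar M}) (e : 'I_d -> M).
Hypothesis x_e : forall i j, x i (e j) = (i == j)%:R.
Hypothesis expand : forall u, u = \sum_(i < d) x i u *: e i.

Lemma multilinear_ext n (W : lmodType k) (g1 g2 : {ffun 'I_n -> M} -> W) :
    multilinear g1 -> multilinear g2 ->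
    (forall a : {ffun 'I_n -> 'I_d},
       g1 [ffun p => e (a p)] = g2 [ffun p => e (a p)]) ->
  g1 =1 g2.
Proof.
move=> l1 l2 h v.
(* The slots are replaced one at a time: all those from [m] on already hold basis
   vectors. *)
suff H m : (m <= n)%N -> forall v : {ffun 'I_n -> M},
    (forall p : 'I_n, (m <= p)%N -> exists i, v p = e i) -> g1 v = g2 v.
  by apply: (H n) => // p; rewrite leqNgt ltn_ord.
elim: m => [_ {}v hv|m IH mn {}v hv].
  have [a ha] := choice (fun p => hv p (leq0n _)).
  have -> : v = [ffun p => e ([ffun p => a p] p)].
    by apply/ffunP=> p; rewrite !ffunE.
  exact: h.
pose p0 := Ordinal mn.
have lin (g : _ -> W) : multilinear g -> linear (fun z => g (upd v p0 z) : W).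
  by move=> lg a s t; rewrite lg.
have upd_id : upd v p0 (v p0) = v.
  by apply/ffunP=> p; rewrite ffunE; case: eqP => [->|].
have sum_lin (g : _ -> W) : multilinear g ->
    g v = \sum_(i < d) x i (v p0) *: g (upd v p0 (e i)).
  move=> lg; pose L := GRing.isLinear.Build k M W _ _ (lin g lg).
  pose F : {linear M -> W} := HB.pack (fun z => g (upd v p0 z)) L.
  have -> : g v = F (v p0) by rewrite /= upd_id.
  rewrite {1}(expand (v p0)) raddf_sum; apply: eq_bigr => i _.
  exact: (linearZ_LR F).
rewrite (sum_lin g1) // (sum_lin g2) //; apply: eq_bigr => i _.
congr (_ *: _); apply: IH => [|p mp]; first exact: ltnW.
rewrite ffunE; case: eqP => [_|np]; first by exists i.
apply: hv; rewrite ltn_neqAle mp andbT; apply/eqP => E.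
by apply: np; apply: val_inj.
Qed.

(** Both sides are linear in [t], so tensors of basis vectors suffice; there, by duality of [x] and
    [e], only one summand survives. *)
Lemma tpow_expand n (t : tpow n M) :
  t = \sum_(a : {ffun 'I_n -> 'I_d})
        prod_form (fun p => x (a p)) t *: tens [ffun p => e (a p)].
Proof.
have lx n' (a : {ffun 'I_n' -> 'I_d}) p : scalar (x (a p)).
  by move=> b u v; rewrite linearP.
pose G (s : tpow n M) := \sum_(a : {ffun 'I_n -> 'I_d})
  prod_form (fun p => x (a p)) s *: tens [ffun p => e (a p)].
have lG : linear G.
  move=> b u v; rewrite scaler_sumr -big_split; apply: eq_bigr => a _.
  by rewrite prod_form_scalar // scalerDl scalerA.
apply: (tpow_ext (f1 := id) _ lG) => [|v]; first by [].
suff E : @tens k n M =1 G \o @tens k n M by exact: E v.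
apply: multilinear_ext => {v}.
- exact: tens_multilinear.
- by move=> u i b s s' /=; rewrite tens_multilinear lG.
move=> a; rewrite /G /= (bigD1 a) //= big1 ?addr0 => [|b ab].
  rewrite prod_form_tens // big1 ?scale1r // => p _.
  by rewrite ffunE x_e eqxx.
rewrite prod_form_tens //.
have [p hp] : exists p, b p != a p.
  apply/existsP; rewrite -negb_forall; apply: contraNN ab => /forallP h.
  by apply/eqP/ffunP => p; apply/eqP.
by rewrite (bigD1 p) //= ffunE x_e (negPf hp) mul0r scale0r.
Qed.

(** An intertwiner is determined by its values on a basis of the Specht module, and these by their
    tensor coordinates. The functionals on the right thus have zero common kernel, and [scalar_span]
    applies. *)
Lemma schur_form_expand (lam : intpart) (u : schur lam M -> k)
    (b := vbasis {:specht k lam}) : scalar u ->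
  exists c, forall phi, u phi =
    \sum_(ja : 'I_(\dim {:specht k lam}) * {ffun 'I_(sumn lam) -> 'I_d})
      c ja * prod_form (fun p => x (ja.2 p)) (val phi b`_ja.1).
Proof.
move=> lu.
pose J : finType :=
  ('I_(\dim {:specht k lam}) * {ffun 'I_(sumn lam) -> 'I_d})%type.
have lx (a : {ffun 'I_(sumn lam) -> 'I_d}) p : scalar (x (a p)).
  by move=> r s t; rewrite linearP.
have lm (i : 'I_#|J|) : scalar (fun phi : schur lam M =>
    prod_form (fun p => x ((enum_val i).2 p)) (val phi b`_(enum_val i).1) : k).
  by move=> r s t; rewrite schur_valP; exact: (prod_form_scalar (lx _)).
have [|c hc] := scalar_span lm lu.
  move=> phi h; have -> : phi = 0.
    apply/val_inj/funext => z /=; have /asboolP[l _] := valP phi.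
    pose F : {linear specht k lam -> tpow (sumn lam) M} :=
      HB.pack (val phi) (GRing.isLinear.Build k _ _ _ _ l).
    rewrite -[LHS]/(F z) (coord_vbasis (memvf z)) raddf_sum big1 // => j _.
    apply: etrans (linearZ_LR F _ _) _; rewrite /= [val phi _]tpow_expand.
    rewrite big1 ?scaler0 // => a _.
    have := h (enum_rank ((j, a) : J)); rewrite /= enum_rankK /= => ->.
    by rewrite scale0r.
  by have := lu (-1) 0 0; rewrite scaler0 addr0 mulN1r addNr.
exists (fun ja => c (enum_rank ja)) => phi.
rewrite hc [RHS](reindex (@enum_val J xpredT)) /=.
  by apply: eq_bigr => i _; rewrite enum_valK.
exact/onW_bij/enum_val_bij.
Qed.
End FiniteDimensional.

(** * Images of linear maps as subspaces, and dimension *)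

Section ImageSubspace.
Variables (k : fieldType) (M V : lmodType k) (F : {linear M -> V}).

Definition image_pred : {pred V} := fun v => `[< exists u, F u = v >].

Lemma image_closed : submod_closed image_pred.
Proof.
split; first by apply/asboolP; exists 0; rewrite linear0.
move=> a _ _ /asboolP[u <-] /asboolP[v <-]; apply/asboolP.
by exists (a *: u + v); rewrite linearP.
Qed.

HB.instance Definition _ :=
  GRing.isSubmodClosed.Build k V image_pred image_closed.

Lemma mem_image u : F u \in image_pred.
Proof. by apply/asboolP; exists u. Qed.

Definition corestrict u : subsp image_pred := Subsp (mem_image u).

Lemma corestrict_is_linear : linear corestrict.
Proof. by move=> a u v; apply/val_inj; rewrite /= linearP. Qed.
HB.instance Definition _ := GRing.isLinear.Build k M (subsp image_pred) _
  corestrict corestrict_is_linear.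

Lemma corestrict_bij : injective F -> bijective corestrict.
Proof.
move=> Finj.
have hv (v : subsp image_pred) : exists u, F u = val v.
  by case: v => v /= /asboolP.
have [g hg] := choice hv.
exists g => [u|v]; first by apply: Finj; rewrite hg.
by apply/val_inj; rewrite /= hg.
Qed.

Lemma has_dim_image d : injective F -> has_dim M d -> has_dim (subsp image_pred) d.
Proof.
move=> /corestrict_bij[g fK gK] [[v2r lv [r2v vK rK]]].
constructor; exists (v2r \o g); last first.
  by exists (corestrict \o r2v); exact: can_comp.
move=> a s t /=; rewrite -lv; congr v2r; apply: (can_inj fK).
by rewrite corestrict_is_linear !gK.
Qed.
End ImageSubspace.

Lemma has_dim_basis (k : fieldType) (M : lmodType k) d : has_dim M d ->
  exists (x : 'I_d -> {scalar M}) (e : 'I_d -> M),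
    (forall i j, x i (e j) = (i == j)%:R) /\
    (forall u, u = \sum_(i < d) x i u *: e i).
Proof.
move=> [[v2r lv [r2v vK rK]]].
have lx i : scalar (fun u => v2r u 0 i) by move=> a s t; rewrite lv !mxE.
pose x i : {scalar M} :=
  HB.pack (fun u => v2r u 0 i) (GRing.isLinear.Build k M k _ _ (lx i)).
exists x, (fun j => r2v (delta_mx 0 j)); split=> [i j|u].
  by rewrite /= rK mxE eqxx eq_sym.
pose F : {linear M -> 'rV[k]_d} := HB.pack v2r (GRing.isLinear.Build k _ _ _ _ lv).
apply: (can_inj vK); rewrite -[RHS]/(F _) raddf_sum /=.
rewrite [LHS]row_sum_delta; apply: eq_bigr => i _.
by rewrite -[RHS]/(F _) linearZ /= rK.
Qed.

Lemma sumn_intpart_gt0 (lam : intpart) : parts lam <> [::] -> (0 < sumn lam)%N.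
Proof.
case: lam => -[//|a s] /= /andP[_]; rewrite inE negb_or eq_sym -lt0n => /andP[a0 _].
by rewrite addn_gt0 a0.
Qed.

(** * A finite-dimensional space receiving all [d]-dimensional ones *)

Section Universal.
Variables (k : fieldType) (r d : nat) (lam : r.-tuple intpart).

Local Notation size_ i := (sumn (tnth lam i)).
Local Notation specht_ i := (specht k (tnth lam i)).
Local Notation term_ i :=
  ('I_(\dim {:specht_ i}) * {ffun 'I_(size_ i) -> 'I_d})%type.

(* [inl] indexes the coordinates of the embedded space itself, [inr] the
   variables of the forms. *)
Definition univ_coord : finType :=
  ('I_d + {i : 'I_r & (term_ i * 'I_(size_ i))%type})%type.

Definition univ_space := {ffun univ_coord -> k^o}.
HB.instance Definition _ := Vector.on univ_space.

Definition univ_form i (phi : schur (tnth lam i) univ_space) : k :=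
  \sum_(ja : term_ i)
    prod_form (fun p (v : univ_space) => v (inr (Tagged _ (ja, p))) : k)
      (val phi (vbasis {:specht_ i})`_ja.1).

Lemma coord_scalar c : scalar (fun v : univ_space => v c : k).
Proof. by move=> a s t; rewrite !ffunE. Qed.

Lemma univ_form_is_scalar i : scalar (@univ_form i).
Proof.
move=> a s t; rewrite mulr_sumr -big_split; apply: eq_bigr => ja _.
rewrite schur_valP; exact: (prod_form_scalar (fun p => @coord_scalar _)).
Qed.
HB.instance Definition _ i := GRing.isLinear.Build k _ k _ _
  (@univ_form_is_scalar i).

Definition univ_structure : lam_structure lam univ_space :=
  fun i => @univ_form i.

Lemma univ_structureP (M : lmodType k) (w : lam_structure lam M) :
    pure lam -> has_dim M d ->
  exists f : {linear M -> univ_space}, embedding w univ_structure f.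
Proof.
move=> lam_pure /has_dim_basis[x [e [x_e expand]]].
have p0 i : 'I_(size_ i) by exact: Ordinal (sumn_intpart_gt0 (lam_pure i)).
have lw i : scalar (w i) by move=> a s t; rewrite linearP.
(* The index type of the coefficients depends on [i], so they are extracted separately for each
   form. *)
pose c i := sval (cid (schur_form_expand x_e expand (lw i))).
have w_expand i phi := svalP (cid (schur_form_expand x_e expand (lw i))) phi.
pose F (u : M) : univ_space := [ffun q => match q with
  | inl i => x i u
  | inr (existT i (ja, p)) => (if p == p0 i then c i ja else 1) * x (ja.2 p) u
  end].
have lF : linear F.
  move=> a s t; apply/ffunP => -[i|[i [ja p]]]; rewrite !ffunE linearP //=.
  by rewrite mulrDr mulrCA.
pose f : {linear M -> univ_space} := HB.pack F (GRing.isLinear.Build k _ _ _ _ lF).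
exists f; split=> [u v fuv|i phi].
  (* Injectivity is read off the [inl] components, which are the coordinates of the vector. *)
  rewrite [u]expand [v]expand; apply: eq_bigr => i _; congr (_ *: _).
  by have /ffunP/(_ (inl i)) := fuv; rewrite !ffunE.
rewrite w_expand; apply: eq_bigr => ja _.
have lx p : scalar (x (ja.2 p)) by move=> a s t; rewrite linearP.
rewrite -(prod_form_scale (p0 i)) // /= prod_form_map; last first.
  by move=> p; exact: coord_scalar.
congr (prod_form _ _); apply/funext => p; apply/funext => u.
by rewrite /= ffunE.
Qed.
End Universal.

(** * Linear oligomorphy from universality and homogeneity *)

Lemma vectType_has_dim (k : fieldType) (U : vectType k) : has_dim U (\dim {:U}).
Proof.
have lx i : scalar (coord (vbasis {:U}) i) by move=> a s t; rewrite linearP.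
constructor; exists (fun u => \row_i coord (vbasis {:U}) i u).
  by move=> a u v; apply/rowP => i; rewrite !mxE linearP.
exists (fun v : 'rV_(\dim {:U}) => \sum_i v 0 i *: (vbasis {:U})`_i) => [u|v].
  by under eq_bigr do rewrite mxE; rewrite -coord_vbasis ?memvf.
apply/rowP => i; rewrite mxE coord_sum_free //.
exact/basis_free/vbasisP.
Qed.

Theorem theorem4p7 (k : fieldType) (hk : [pchar k] =i pred0)
    (r : nat) (lam : r.-tuple intpart) (hlam : pure lam)
    (V : lmodType k) (w : lam_structure lam V)
    (hdim : has_countably_infinite_dim V)
    (huniv : universal w) (hhom : homogeneous w) :
  linear_oligomorphic (automorphism_group w).
Proof.
move=> d; have [h [h_inj h_pres]] := huniv _ (univ_structure k d lam).
exists (image_pred h : submodClosed V); split.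
  by exists (\dim {:univ_space k d lam}); apply/has_dim_image/vectType_has_dim.
move=> W dimW.
have [f [f_inj f_pres]] := univ_structureP (induced w W) hlam dimW.
pose F : {linear subsp W -> V} := h \o f.
have F_inj : injective F by exact: inj_comp.
(* [F] is a second embedding of [W] into [V], now with image inside that of [h]. Homogeneity will
   move [W] itself onto this image. *)
have iso : isomorphism (induced w W) (induced w (image_pred F)) (corestrict F).
  have bF := corestrict_bij F_inj; split=> //; split=> [|i phi].
    exact: bij_inj bF.
  (* Both forms become pullbacks of [w i] along [F], factored once through the inclusion of its
     image and once as [h \o f]. *)
  rewrite -f_pres -[RHS]h_pres /=; congr (w i _).
  rewrite -[LHS](@schur_map_comp _ _ _ _ _ _ _ F) //.
  exact: schur_map_comp.
have [||g [g_iso gE]] := hhom _ _ _ _ _ iso.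
- by exists d.
- by exists d; exact: has_dim_image.
exists g; split=> // u Wu.
by rewrite -[u]/(val (Subsp Wu)) gE; exact: mem_image.
Qed.
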